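(* For every $p\in[1,\infty]$ and every realization $\omega^N$ one has $$\|\widehat\beta(\omega^N)-\beta\|_p\ \le\ \frac{\|F_{\omega^N}(\beta)\|_\infty}{\sqrt{\theta_p[A[\omega^N]]\,\theta_1[A[\omega^N]]}} .$$ As a result, for every $\epsilon\in(0,1)$, the probability of the event $$\|\widehat\beta(\omega^N)-\beta\|_p\ \le\ \left(\theta_p[A[\omega^N]]\,\theta_1[A[\omega^N]]\right)^{-1}\left(\sqrt{\frac{\ln(2\kappa/\epsilon)}{2N}}+\frac{\ln(2\kappa/\epsilon)}{3N}\right)\quad\text{for all }p\in[1,\infty]$$ is at least $1-\epsilon$. (Right-hand sides are read as $+\infty$ when $\theta_p[A[\omega^N]]\,\theta_1[A[\omega^N]]=0$.)
   Context: Single-state spatio-temporal Bernoulli process with memory depth $d$. Let $K,d,N\ge 1$ be integers and $\kappa=K+dK^2$. A random process $\omega_t=(\omega_{t1},\dots,\omega_{tK})\in\{0,1\}^K$, $-d+1\le t\le N$, is observed. Write $\omega^t=\{\omega_{sk}:-d+1\le s\le t,\ 1\le k\le K\}$ and $\omega_\tau^t=\{\omega_{sk}:\tau\le s\le t,\ 1\le k\le K\}$. The parameter vector $\beta\in\mathbb{R}^\kappa$ collects the reals $\beta_k$ ($1\le k\le K$) and $\beta^s_{k\ell}$ ($1\le s\le d$, $1\le k,\ell\le K$). For $t\ge1$, the conditional probability of $\omega_{tk}=1$ given $\omega^{t-1}$ is $$\beta_k+\sum_{s=1}^d\sum_{\ell=1}^K\beta^s_{k\ell}\,\omega_{(t-s)\ell},\quad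 1\le k\le K.$$ Let $\mathcal{B}\subset\mathbb{R}^\kappa$ be the set of all $\beta$ satisfying, for all $k\le K$, $$0\le \beta_k+\sum_{s=1}^d\sum_{\ell=1}^K\min[\beta^s_{k\ell},0],\qquad 1\ge \beta_k+\sum_{s=1}^d\sum_{\ell=1}^K\max[\beta^s_{k\ell},0].$$ A convex compact set $\mathcal{X}\subset\mathcal{B}$ containing the true parameter vector $\beta$ is given. The matrix $\eta(\omega_{t-d}^{t-1})\in\{0,1\}^{\kappa\times K}$ is the one for which, for every $x\in\mathbb{R}^\kappa$ (with coordinates indexed as those of $\beta$), the $k$-th entry of $\eta^T(\omega_{t-d}^{t-1})x$ is $x_k+\sum_{s=1}^d\sum_{\ell=1}^K x^s_{k\ell}\omega_{(t-s)\ell}$; here $\eta^T(\cdot)$ is the transpose of $\eta(\cdot)$. Thus the conditional expectation of $\omega_t$ given $\omega^{t-1}$ is $\eta^T(\omega_{t-d}^{t-1})\beta$. All probabilities are conditional on a fixed realization of the initial fragment $\omega_{-d+1}^0$. Set $$A[\omega^N]=\frac1N\sum_{t=1}^N\eta(\omega_{t-d}^{t-1})\eta^T(\omega_{t-d}^{t-1}),\qquad a[\omega^N]=\frac1N\sum_{t=1}^N\eta(\omega_{t-d}^{t-1})\omega_t,\qquad F_{\omega^N}(x)=A[\omega^N]x-a[\omega^N].$$ The estimate $\widehat\beta(\omega^N)\in\mathcal{X}$ is a weak solution of the variational inequality $\mathrm{VI}[F_{\omega^N},\mathcal{X}]$, i.e. a point $z\in\mathcal{X}$ with $\langle F_{\omega^N}(w),w-z\rangle\ge0$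 for all $w\in\mathcal{X}$; equivalently, it is a minimizer over $x\in\mathcal{X}$ of the least squares objective $\frac1{2N}\sum_{t=1}^N\|\eta^T(\omega_{t-d}^{t-1})x-\omega_t\|_2^2$. For a symmetric positive semidefinite $A\in\mathbb{R}^{\kappa\times\kappa}$ and $p\in[1,\infty]$, $$\theta_p[A]:=\max\left\{\theta\ge0:\ g^TAg\ge\theta\|g\|_p^2\ \ \forall g\in\mathbb{R}^\kappa\right\}.$$ *)

(* Defs.v *)
From HB Require Import structures.
From mathcomp Require Import all_boot all_order all_algebra.
From mathcomp Require Import all_classical all_reals all_analysis.

Set Implicit Arguments.
Unset Strict Implicit.
Unset Printing Implicit Defensive.

Import Order.TTheory GRing.Theory Num.Theory.
Import numFieldNormedType.Exports.

Local Open Scope classical_set_scope.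
Local Open Scope ring_scope.

Section LpNorm.
Context {R : realType} {n : nat}.
Implicit Types (p : \bar R) (u v g : 'cV[R]_n) (A : 'M[R]_n).

Definition dotv u v : R := (u^T *m v) 0 0.

(* Only meaningful for 1 <= p; the value at -oo is irrelevant. *)
Definition lpnorm p u : R :=
  match p with
  | r%:E => (\sum_(i < n) `|u i 0| `^ r) `^ r^-1
  | +oo%E => \big[Num.max/0]_(i < n) `|u i 0|
  | -oo%E => 0
  end.

Definition theta_set p A : set R :=
  [set th | 0 <= th /\ forall g, th * lpnorm p g ^+ 2 <= (g^T *m A *m g) 0 0].

(* For A positive semidefinite and n > 0 the supremum is a maximum, see
   [theta_max]. *)
Definition theta p A : R := sup (theta_set p A).

Lemma lpnorm_ge0 p u : 0 <= lpnorm p u.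
Proof.
case: p => [r| |] //=; first exact: powR_ge0.
by elim/big_ind: _ => // x y x0 y0; rewrite le_max x0.
Qed.

Lemma lpnorm_delta p (i : 'I_n) : (1 <= p)%E -> lpnorm p (delta_mx i 0) = 1.
Proof.
case: p => [r| |] //=.
- rewrite lee_fin => r1; have r0 : r != 0 by rewrite gt_eqF // (lt_le_trans ltr01).
  rewrite (bigD1 i) //= mxE !eqxx normr1 powR1 big1 ?addr0 ?powR1 // => j ji.
  by rewrite mxE (negbTE ji) normr0 powR0.
- move=> _; apply/eqP; rewrite eq_le; apply/andP; split.
    apply/bigmax_leP; split => // j _; rewrite mxE.
    by case: eqP => _; rewrite ?normr1 ?normr0.
  by apply: (bigmax_sup i) => //; rewrite mxE !eqxx normr1.
Qed.

Lemma theta_max p A : (0 < n)%N -> (1 <= p)%E ->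
    (forall g, 0 <= (g^T *m A *m g) 0 0) ->
  theta_set p A (theta p A) /\ ubound (theta_set p A) (theta p A).
Proof.
move=> n0 p1 A0; set i0 := Ordinal n0.
have t0 : theta_set p A 0 by split => // g; rewrite mul0r.
have ubS : has_ubound (theta_set p A).
  pose e : 'cV[R]_n := delta_mx i0 0.
  exists ((e^T *m A *m e) 0 0) => th [_ /(_ e)].
  by rewrite lpnorm_delta // expr1n mulr1.
have ub : ubound (theta_set p A) (theta p A) by move=> x xS; exact: ub_le_sup.
split=> //; split; first exact: ub.
move=> g; have [->|g0] := eqVneq (lpnorm p g) 0.
  by rewrite expr0n mulr0.
have gp : 0 < lpnorm p g ^+ 2 by rewrite exprn_gt0 // lt_neqAle eq_sym g0 lpnorm_ge0.
rewrite -ler_pdivlMr //; apply: ge_sup; first by exists 0.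
by move=> th [_ /(_ g)]; rewrite -ler_pdivlMr.
Qed.

End LpNorm.

(* Right-hand sides with a vanishing denominator are read as +oo. *)
Definition unless0 {R : realType} (den v : R) : \bar R :=
  if den == 0 then +oo%E else v%:E.

Definition kappa (K d : nat) : nat := (K + d * K ^ 2)%N.

Section Model.
Context {R : realType} {K d N : nat}.

(* Lags are shifted by one: s : 'I_d stands for the lag s + 1. *)
Definition bconst (x : 'cV[R]_(kappa K d)) (k : 'I_K) : R :=
  x (lshift (d * K ^ 2) k) 0.
Definition blag (x : 'cV[R]_(kappa K d)) (s : 'I_d) (k l : 'I_K) : R :=
  x (rshift K (mxvec_index s (mxvec_index k l))) 0.

Definition Bset : set 'cV[R]_(kappa K d) :=
  [set b | forall k : 'I_K,
     0 <= bconst b k + \sum_(s < d) \sum_(l < K) Num.min (blag b s k l) 0 /\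
     bconst b k + \sum_(s < d) \sum_(l < K) Num.max (blag b s k l) 0 <= 1].

(* Row s of a window is the state of the process s + 1 steps before the
   current time. *)
Definition intensity (h : 'M[bool]_(d, K)) (x : 'cV[R]_(kappa K d)) (k : 'I_K)
  : R :=
  bconst x k + \sum_(s < d) \sum_(l < K) blag x s k l * (h s l)%:R.

(* The matrix with eta^T x = intensity h x for all x, see [eta_trP]. *)
Definition eta (h : 'M[bool]_(d, K)) : 'M[R]_(kappa K d, K) :=
  \matrix_(i, k) intensity h (delta_mx i 0) k.

Lemma eta_trP h x k : ((eta h)^T *m x) k 0 = intensity h x k.
Proof.
have lin : scalar (fun x => intensity h x k).
  move=> a u v; rewrite /intensity /bconst /blag !mxE mulrDr addrACA.
  congr (_ + _); rewrite mulr_sumr -big_split; apply: eq_bigr => s _ /=.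
  rewrite mulr_sumr -big_split; apply: eq_bigr => l _ /=.
  by rewrite !mxE mulrDl mulrA.
pose L := GRing.isLinear.Build _ _ _ _ _ lin.
pose f : {scalar 'cV[R]_(kappa K d)} := HB.pack (fun x => intensity h x k) L.
rewrite -[RHS]/(f x) {2}(matrix_sum_delta x) linear_sum mxE.
apply: eq_bigr => i _; rewrite big_ord1 linearZ /= !mxE mulrC.
by [].
Qed.

Lemma eta01 h i k : eta h i k = 0 \/ eta h i k = 1.
Proof.
rewrite mxE /intensity /bconst /blag.
case: (split_ordP i) => [k' ->|j ->].
  rewrite mxE eqxx andbT big1 => [|s _]; last first.
    by apply: big1 => l _; rewrite mxE eq_rlshift mul0r.
  by rewrite addr0; case: eqP; [right|left].
rewrite mxE eq_lrshift add0r.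
case/mxvec_indexP: j => s kl.
rewrite -[kl]/(kl : 'I_(K * K)); case/mxvec_indexP: kl => k' l.
have inj m n (a b : 'I_m) (a' b' : 'I_n) :
    (mxvec_index a a' == mxvec_index b b') = ((a, a') == (b, b')).
  apply/eqP/eqP => [E|[-> ->]//].
  have [g gK _] := curry_mxvec_bij m n.
  by rewrite -[LHS]gK ?inE // -[RHS]gK ?inE //= E.
suff -> : \sum_(s0 < d) \sum_(l0 < K)
    (delta_mx (rshift K (mxvec_index s (mxvec_index k' l))) 0 : 'cV[R]_(kappa K d))
      (rshift K (mxvec_index s0 (mxvec_index k l0))) 0 * (h s0 l0)%:R
    = (k == k')%:R * (h s l)%:R.
  by case: (k == k'); case: (h s l); rewrite ?mulr1 ?mulr0; [right|left..].
rewrite (bigD1 s) //= [X in _ + X]big1 ?addr0 => [|s' s's]; last first.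
  apply: big1 => l' _.
  by rewrite mxE eq_rshift inj xpair_eqE (negbTE s's) mul0r.
rewrite (bigD1 l) //= [X in _ + X]big1 ?addr0 => [|l' l'l]; last first.
  by rewrite mxE eq_rshift !(inj, xpair_eqE) (negbTE l'l) !andbF mul0r.
by rewrite mxE eq_rshift !(inj, xpair_eqE) !eqxx !andbT.
Qed.

(* Row j of a trajectory w : 'M[bool]_(d + N, K) is the state at time
   j - d + 1, so rows 0, ..., d-1 form the initial fragment and t : 'I_N stands
   for the time t + 1, stored in row [rshift d t]. *)

Lemma lag_subproof (t : 'I_N) (s : 'I_d) : (d + t - s.+1 < d + N)%N.
Proof. by rewrite (leq_ltn_trans (leq_subr _ _)) // ltn_add2l. Qed.

Definition window (w : 'M[bool]_(d + N, K)) (t : 'I_N) : 'M[bool]_(d, K) :=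
  \matrix_(s, l) w (Ordinal (lag_subproof t s)) l.

Definition state (w : 'M[bool]_(d + N, K)) (t : 'I_N) : 'cV[R]_K :=
  \col_k (w (rshift d t) k)%:R.

Definition Amat (w : 'M[bool]_(d + N, K)) : 'M[R]_(kappa K d) :=
  N%:R^-1 *: \sum_(t < N) eta (window w t) *m (eta (window w t))^T.

Definition avec (w : 'M[bool]_(d + N, K)) : 'cV[R]_(kappa K d) :=
  N%:R^-1 *: \sum_(t < N) eta (window w t) *m state w t.

Definition Fop (w : 'M[bool]_(d + N, K)) (x : 'cV[R]_(kappa K d)) :
    'cV[R]_(kappa K d) :=
  Amat w *m x - avec w.

End Model.

Definition weak_VI_solution {R : realType} {n : nat}
    (F : 'cV[R]_n -> 'cV[R]_n) (X : set 'cV[R]_n) (z : 'cV[R]_n) : Prop :=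
  X z /\ forall w, X w -> 0 <= dotv (F w) (w - z).

Section Process.
Context {disp : measure_display} {T : measurableType disp} {R : realType}.
Context {K d N : nat}.
Variables (P : probability T R) (omega : 'I_(d + N) -> 'I_K -> {RV P >-> bool}).

(* Conditional probability of A given B, for P B != 0. *)
Definition condP (A B : set T) : R := fine (P (A `&` B)) / fine (P B).

Definition trajectory (x : T) : 'M[bool]_(d + N, K) :=
  \matrix_(j, k) omega j k x.

Definition initial_event (w0 : 'M[bool]_(d, K)) : set T :=
  [set x | forall (j : 'I_d) (k : 'I_K), omega (lshift N j) k x = w0 j k].

(* The event that everything observed strictly before t agrees with h. *)
Definition history_event (t : 'I_N) (h : 'M[bool]_(d + N, K)) : set T :=
  [set x | forall (j : 'I_(d + N)) (k : 'I_K), (j < d + t)%N ->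
     omega j k x = h j k].

(* Only the one-dimensional conditional laws are prescribed: given the past,
   the coordinates of the current state may depend on each other. *)
Definition bernoulli_process (beta : 'cV[R]_(kappa K d)) : Prop :=
  forall (t : 'I_N) (h : 'M[bool]_(d + N, K)),
    P (history_event t h) != 0%E ->
    forall k : 'I_K,
      condP [set x | omega (rshift d t) k x = true] (history_event t h)
      = intensity (window h t) beta k.

End Process.

(* Main.v *)
Require Import Defs.
From HB Require Import structures.
From mathcomp Require Import all_boot all_order all_algebra.
From mathcomp Require Import all_classical all_reals all_analysis.
From mathcomp Require Import ring lra.

Import Order.TTheory GRing.Theory Num.Theory.
Import numFieldNormedType.Exports.

Local Open Scope classical_set_scope.
Local Open Scope ring_scope.

(** The field of the variational inequality is affine and monotone, so a weak
    solution [z] is a strong one; with [D = z - beta] this gives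
    [D^T A D <= - <F beta, D> <= |F beta|_oo |D|_1], and bounding [D^T A D] from
    below by [theta_1 |D|_1^2] and by [theta_p |D|_p^2] yields the first claim.

    Every coordinate of [N F beta] is a sum of martingale differences
    [e (q - xi)], where [e] is 0 or 1 and [xi] is Bernoulli of parameter [q]
    given the past, because each row of [eta] is supported in a single column.
    Bernstein's inequality with variance at most [1 / 4] and a union bound over
    coordinates and signs control [|F beta|_oo].  The diagonal of [A] contains
    ones, hence [theta_p <= 1] and the square root may be dropped.  As the
    process has finitely many trajectories, the martingale argument is carried
    out with finite sums over them. *)

(* HB also exports a constant named [eta]. *)
Local Notation eta := Defs.eta.

(** * The deterministic bound *)

Section Deterministic.
Context {R : realType} {n : nat}.
Implicit Types (u v z b : 'cV[R]_n) (A : 'M[R]_n).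

Lemma dotvE u v : dotv u v = \sum_i u i 0 * v i 0.
Proof. by rewrite /dotv mxE; apply: eq_bigr => i _; rewrite mxE. Qed.

Lemma dotvDZl (s : R) u v z : dotv (u + s *: v) z = dotv u z + s * dotv v z.
Proof.
rewrite !dotvE mulr_sumr -big_split; apply: eq_bigr => i _ /=.
by rewrite !mxE mulrDl mulrA.
Qed.

Lemma dotvZr (s : R) u v : dotv u (s *: v) = s * dotv u v.
Proof.
by rewrite !dotvE mulr_sumr; apply: eq_bigr => i _; rewrite mxE mulrCA.
Qed.

Lemma dotv_quad A u : (u^T *m A *m u) 0 0 = dotv (A *m u) u.
Proof.
rewrite -mulmxA mxE dotvE; apply: eq_bigr => i _.
by rewrite mxE mulrC.
Qed.

(** Minty's argument: the weak inequality is tested at [s *: b + (1 - s) *: z], a point of [X] by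
    convexity. Dividing by [s] leaves [c + (1 - s) * q <= 0], and the claim is the case [s = 0]. *)
Lemma weak_VI_affine_ineq A (a : 'cV[R]_n) (X : set 'cV[R]_n) z b :
  convex_set X -> X b -> 0 <= dotv (A *m (z - b)) (z - b) ->
  weak_VI_solution (fun x => A *m x - a) X z ->
  dotv (A *m (z - b)) (z - b) <= - dotv (A *m b - a) (z - b).
Proof.
move=> cX Xb q0 [Xz zP].
set q := dotv (A *m (z - b)) (z - b) in q0 *.
set c := dotv (A *m b - a) (z - b).
have key s : 0 < s <= 1 -> c + (1 - s) * q <= 0.
  move=> /andP[s0 s1].
  have si : Itv.spec (Itv.num_sem (R := R)) (Itv.Real `[0%Z, 1%Z]) s.
    by rewrite /= /Itv.num_sem /= in_itv /= s1 (ltW s0) num_real.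
  have Xw : X (s *: b + (1 - s) *: z).
    by have := cX b z (Itv.mk si); rewrite !inE; move/(_ Xb Xz).
  have := zP _ Xw.
  have -> : A *m (s *: b + (1 - s) *: z) - a =
            (A *m b - a) + (1 - s) *: (A *m (z - b)).
    rewrite mulmxDr -!scalemxAr mulmxBr.
    by apply/matrixP => i j; rewrite !mxE; ring.
  have -> : s *: b + (1 - s) *: z - z = - s *: (z - b).
    by apply/matrixP => i j; rewrite !mxE; ring.
  by rewrite dotvZr dotvDZl -/c -/q mulNr oppr_ge0 pmulr_rle0.
(* An explicit weight replaces the limit at 0: for [s = (c + q) / (c + 2 q)] one has
   [c + (1 - s) * q = s * (c + q)], which is positive if the claim fails. *)
rewrite leNgt; apply/negP => lt_cq.
have e0 : 0 < c + q by lra.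
have s1 : 0 < (c + q) / (c + q + q) <= 1.
  by rewrite divr_gt0 ?ler_pdivrMr ?mul1r; lra.
have := key _ s1; set s := _ / _.
have sE : s * (c + q + q) = c + q by rewrite /s divfK // gt_eqF //; lra.
have s0 : 0 < s by case/andP: s1.
have : 0 < s * (c + q) by rewrite mulr_gt0.
lra.
Qed.

Lemma lpnorm1E u : lpnorm 1%E u = \sum_i `|u i 0|.
Proof.
rewrite /= invr1 powRr1; last by apply: sumr_ge0 => i _; exact: powR_ge0.
by apply: eq_bigr => i _; rewrite powRr1.
Qed.

Lemma le_lpnormoo u i : `|u i 0| <= lpnorm +oo%E u.
Proof. exact: (bigmax_sup i). Qed.

Lemma normr_dotv_le u v : `|dotv u v| <= lpnorm +oo%E u * lpnorm 1%E v.
Proof.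
rewrite dotvE (le_trans (ler_norm_sum _ _ _)) // lpnorm1E mulr_sumr.
by apply: ler_sum => i _; rewrite normrM ler_wpM2r // le_lpnormoo.
Qed.

Section Theta.
Context {A : 'M[R]_n} (n_gt0 : (0 < n)%N).
Hypothesis A_psd : forall g : 'cV[R]_n, 0 <= (g^T *m A *m g) 0 0.

Lemma theta_ge0 (p : \bar R) : (1 <= p)%E -> 0 <= theta p A.
Proof. by move=> p1; have [[]] := theta_max n_gt0 p1 A_psd. Qed.

Lemma theta_le_quad (p : \bar R) (g : 'cV[R]_n) : (1 <= p)%E ->
  theta p A * lpnorm p g ^+ 2 <= dotv (A *m g) g.
Proof.
by move=> p1; have [[_ /(_ g)]] := theta_max n_gt0 p1 A_psd; rewrite dotv_quad.
Qed.

Lemma theta_le_diag (p : \bar R) i : (1 <= p)%E -> theta p A <= A i i.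
Proof.
move=> p1; have := theta_le_quad p (delta_mx i 0) p1.
rewrite lpnorm_delta // expr1n mulr1 -colE dotvE (bigD1 i) //= big1 ?addr0.
  by rewrite !mxE eqxx mulr1.
by move=> j ji; rewrite !mxE (negbTE ji) mulr0.
Qed.

Lemma weak_VI_affine_bound (a : 'cV[R]_n) (X : set 'cV[R]_n) z b p :
  (1 <= p)%E -> convex_set X -> X b ->
  weak_VI_solution (fun x => A *m x - a) X z ->
  0 < theta p A * theta 1%E A ->
  lpnorm p (z - b) <=
  lpnorm +oo%E (A *m b - a) / Num.sqrt (theta p A * theta 1%E A).
Proof.
move=> p1 cX Xb zP th0.
have q0 : 0 <= dotv (A *m (z - b)) (z - b) by rewrite -dotv_quad.
have := weak_VI_affine_ineq A a X z b cX Xb q0 zP.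
have := normr_dotv_le (A *m b - a) (z - b).
have := theta_le_quad p (z - b) p1.
have := theta_le_quad 1%E (z - b) (lexx _).
have := theta_ge0 1%E (lexx _).
have := theta_ge0 p p1.
have := lpnorm_ge0 p (z - b).
have := lpnorm_ge0 1%E (z - b).
have := lpnorm_ge0 +oo%E (A *m b - a).
rewrite ler_pdivlMr ?sqrtr_gt0 //.
set F := lpnorm +oo _; set x1 := lpnorm 1 _; set xp := lpnorm p _.
set q := dotv _ (z - b) in q0 *; set c := dotv _ (z - b).
move: th0; set tp := theta p A; set t1 := theta 1 A => th0.
move=> F0 x10 xp0 tp0 t10 q1 qp cF qc.
have qF : q <= F * x1.
  by rewrite (le_trans qc) // (le_trans _ cF) // -normrN ler_norm.
have tt1 : 0 < t1.
  rewrite lt_neqAle t10 andbT; apply: contraTneq th0 => <-.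
  by rewrite mulr0 ltxx.
have x1F : t1 * x1 <= F.
  have [->|x1n] := eqVneq x1 0; first by rewrite mulr0.
  have x1p : 0 < x1 by rewrite lt_neqAle eq_sym x1n.
  by rewrite -(ler_pM2r x1p) -mulrA -expr2 (le_trans q1).
(* After squaring, the goal is the chain [t1 * tp * xp ^+ 2 <= t1 * q <= F * (t1 * x1) <= F ^+
   2]. *)
rewrite -(ler_pXn2r (n := 2)) ?nnegrE ?mulr_ge0 ?sqrtr_ge0 //.
rewrite exprMn sqr_sqrtr ?(ltW th0) //.
have : t1 * (tp * xp ^+ 2) <= t1 * (F * x1).
  by rewrite ler_pM2l // (le_trans qp).
have : F * (t1 * x1) <= F * F by rewrite ler_wpM2l.
lra.
Qed.

End Theta.
End Deterministic.

(** * Bernstein's inequality for finite martingales *)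

Section Bernstein.
Context {R : realType}.
Implicit Types x p lam : R.

Lemma MVT_total (f f' : R -> R) (a b : R) :
  (forall y : R, is_derive y (1 : R) f (f' y)) -> a <= b ->
  exists2 c, a <= c <= b & f b = f a + f' c * (b - a).
Proof.
move=> df ab; have cf : {within `[a, b], continuous f}.
  by apply: derivable_within_continuous => y _; have [] := df y.
have [c cab E] := MVT_segment ab (fun y _ => df y) cf.
by exists c; [rewrite in_itv in cab | rewrite -E addrC subrK].
Qed.

(* For [x < 3] this is [expR x <= 1 + x + x ^ 2 / (2 (1 - x / 3))]. *)
Lemma expR_pade_le x : (6 - 2 * x) * expR x <= 6 + 4 * x + x ^+ 2.
Proof.
(* Multiplied by [expR (- x)], the claim becomes [6 <= f x]. Since [g] is nonincreasing with
   [g 0 = 2], the derivative [f' = 2 - g] is nonpositive before 0 and nonnegative after it, so [f]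
   is minimal at 0. *)
pose g (y : R) : R := (2 + 2 * y + y ^+ 2) * expR (- y).
pose g' (y : R) : R := - y ^+ 2 * expR (- y).
pose f (y : R) : R := (6 + 4 * y + y ^+ 2) * expR (- y) + 2 * y.
pose f' (y : R) : R := 2 - g y.
have dg (y : R) : is_derive y (1 : R) g (g' y).
  apply: is_derive_eq; rewrite /g' /GRing.scale /=; ring.
have df (y : R) : is_derive y (1 : R) f (f' y).
  apply: is_derive_eq; rewrite /f' /g /GRing.scale /=; ring.
have g0 : g 0 = 2 by rewrite /g oppr0 expR0; ring.
have f0 : f 0 = 6 by rewrite /f oppr0 expR0; ring.
have g'_le0 y : g' y <= 0.
  by rewrite /g' mulNr oppr_le0 mulr_ge0 ?sqr_ge0 ?expR_ge0.
have fx : 6 <= f x.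
  have [x0|/ltW x0] := leP 0 x.
    have [c /andP[c0 _] ->] := MVT_total f f' 0 x df x0.
    have [e _ Ee] := MVT_total g g' 0 c dg c0.
    rewrite f0 subr0 lerDl mulr_ge0 // /f' Ee g0 subr0.
    by rewrite opprD addrA subrr sub0r oppr_ge0 mulr_le0_ge0.
  have [c /andP[_ c0] E] := MVT_total f f' x 0 df x0.
  have [e _ Ee] := MVT_total g g' c 0 dg c0.
  have : f' c <= 0.
    have := mulr_le0_ge0 (g'_le0 e) (_ : 0 <= 0 - c); rewrite /f' -g0 Ee; lra.
  move=> f'c; rewrite -f0 E gerDl mulr_le0_ge0 //; lra.
have -> : 6 + 4 * x + x ^+ 2 = (f x - 2 * x) * expR x.
  by rewrite /f addrK -mulrA -expRD addNr expR0 mulr1.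
by rewrite ler_pM2r ?expR_gt0 // lerB.
Qed.

Lemma bernoulli_mgf_le p lam : 0 <= p <= 1 -> 0 <= lam < 3 ->
  p * expR (lam * (1 - p)) + (1 - p) * expR (- (lam * p)) <=
  expR (lam ^+ 2 / (8 * (1 - lam / 3))).
Proof.
move=> /andP[p0 p1] /andP[l0 l3].
(* Both exponents are at most [lam], so the denominator [1 - x / 3] can be replaced by the common
   [1 - lam / 3]. *)
have bnd x : x <= lam -> expR x <= 1 + x + 4 * x ^+ 2 * (8 * (1 - lam / 3))^-1.
  move=> xl; have := expR_pade_le x.
  rewrite mulrC -ler_pdivlMr; last lra.
  move/le_trans; apply.
  rewrite ler_pdivrMr; last lra.
  rewrite -[4 * _ * _]mulrA.
  have : x ^+ 2 <= x ^+ 2 * ((1 - x / 3) / (1 - lam / 3)).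
    rewrite ler_peMr ?sqr_ge0 // ler_pdivlMr; lra.
  rewrite invfM; set i := (1 - lam / 3)^-1; nra.
have lp0 : 0 <= lam * p by rewrite mulr_ge0.
have lp1 : 0 <= lam * (1 - p) by rewrite mulr_ge0 // subr_ge0.
have b1 := bnd (lam * (1 - p)) ltac:(lra).
have b2 := bnd (- (lam * p)) ltac:(lra).
apply: le_trans (expR_ge1Dx _); set i := (8 * _)^-1 in b1 b2 *.
have i0 : 0 <= i by rewrite invr_ge0; lra.
have c1 := ler_wpM2l p0 b1.
have c2 := ler_wpM2l (_ : 0 <= 1 - p) b2.
rewrite (le_trans (lerD c1 (c2 _))) ?subr_ge0 //.
(* In the average the linear terms cancel and the quadratic ones add up to [4 * lam ^+ 2 * i] times
   the variance [p * (1 - p)], which is at most 1/4. *)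
have : lam ^+ 2 * i * (1 - 4 * (p * (1 - p))) >= 0.
  rewrite mulr_ge0 // ?mulr_ge0 ?sqr_ge0 //.
  have -> : 1 - 4 * (p * (1 - p)) = (1 - 2 * p) ^+ 2 by ring.
  exact: sqr_ge0.
lra.
Qed.

End Bernstein.

Section FiniteMartingale.
Context {R : realType} {W : finType}.
Variables (mu : W -> R).
Hypothesis mu_ge0 : forall w, 0 <= mu w.
Implicit Types lam psi q : R.

(** This is [bernoulli_mgf_le] scaled by the mass of [A]: the exponent is [lam * (1 - q)] where [xi]
    holds and [- (lam * q)] elsewhere. The conditional law is written as a product, so [A] may have
    mass zero. *)
Lemma centered_bernoulli_mgf (A xi : pred W) q lam :
  0 <= q <= 1 -> 0 <= lam < 3 ->
  \sum_(w | A w && xi w) mu w = q * \sum_(w | A w) mu w ->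
  \sum_(w | A w) mu w * expR (lam * ((xi w)%:R - q)) <=
  expR (lam ^+ 2 / (8 * (1 - lam / 3))) * \sum_(w | A w) mu w.
Proof.
move=> q01 lam03 Eq.
have A0 : 0 <= \sum_(w | A w) mu w by exact: sumr_ge0.
apply: le_trans (ler_wpM2r A0 (bernoulli_mgf_le q lam q01 lam03)).
rewrite (bigID xi) /= mulrDl -(mulrAC q) -Eq mulr_suml.
have -> : (1 - q) * expR (- (lam * q)) * (\sum_(w | A w) mu w) =
    (\sum_(w | A w && ~~ xi w) mu w) * expR (- (lam * q)).
  rewrite mulrAC mulrBl mul1r -Eq [X in X - _](bigID xi) /=.
  by rewrite addrAC subrr add0r.
rewrite mulr_suml lerD //.
  by apply: ler_sum => w /andP[_ ->].
by apply: ler_sum => w /andP[_ /negbTE ->]; rewrite sub0r mulrN.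
Qed.

Context {C : finType} {N : nat}.
Variables (tr : 'I_N -> W -> C) (D : 'I_N -> W -> R).
Hypothesis D_adapted : forall (s t : 'I_N) w w',
  (s < t)%N -> tr t w = tr t w' -> D s w = D s w'.

(** The fibers of [tr t] are the atoms of the past of [t]. On each of them the sum of the earlier
    increments is a constant, so its exponential factors out and the one-step bound applies. *)
Lemma exp_supermartingale lam psi :
  (forall (t : 'I_N) c, \sum_(w | tr t w == c) mu w * expR (lam * D t w) <=
     expR psi * \sum_(w | tr t w == c) mu w) ->
  \sum_w mu w * expR (lam * \sum_t D t w) <=
  expR (N%:R * psi) * \sum_w mu w.
Proof.
move=> step.
(* The induction truncates the sum of increments, keeping the index type ['I_N] fixed. *)
suff H n : (n <= N)%N ->
    \sum_w mu w * expR (lam * \sum_(t < N | (t < n)%N) D t w) <=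
    expR (n%:R * psi) * \sum_w mu w.
  have := H N (leqnn N); congr (_ <= _); apply: eq_bigr => w _.
  by congr (_ * expR (_ * _)); apply: eq_bigl => t; rewrite ltn_ord.
elim: n => [_|n IH nN].
  rewrite mul0r expR0 mul1r ler_sum // => w _.
  by rewrite big_pred0 // mulr0 expR0 mulr1.
pose t := Ordinal nN.
apply: (@le_trans _ _ (expR psi *
    \sum_w mu w * expR (lam * \sum_(s < N | (s < n)%N) D s w))); last first.
  rewrite -natr1 mulrDl mul1r addrC expRD -mulrA ler_wpM2l ?expR_ge0 //.
  exact: IH (ltnW nN).
rewrite mulr_sumr (partition_big (tr t) xpredT) //=.
rewrite [leRHS](partition_big (tr t) xpredT) //=.
apply: ler_sum => c _.
have [w0 /eqP w0c|none] := pickP (fun w => tr t w == c); last first.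
  by rewrite !big_pred0.
pose E := expR (lam * \sum_(s < N | (s < n)%N) D s w0).
have SE w : tr t w == c ->
    expR (lam * \sum_(s < N | (s < n)%N) D s w) = E.
  move=> /eqP wc; congr (expR (lam * _)); apply: eq_bigr => s sn.
  by apply: (D_adapted s t) => //; rewrite wc w0c.
have -> : \sum_(w | tr t w == c)
    expR psi * (mu w * expR (lam * \sum_(s < N | (s < n)%N) D s w)) =
    (expR psi * \sum_(w | tr t w == c) mu w) * E.
  by rewrite mulr_sumr mulr_suml; apply: eq_bigr => w wc; rewrite SE // mulrA.
have -> : \sum_(w | tr t w == c)
    mu w * expR (lam * \sum_(s < N | (s < n.+1)%N) D s w) =
    (\sum_(w | tr t w == c) mu w * expR (lam * D t w)) * E.
  rewrite mulr_suml; apply: eq_bigr => w wc.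
  rewrite -mulrA -(SE w wc) -expRD -mulrDr; congr (_ * expR (_ * _)).
  rewrite (bigD1 t) ?leqnn //=; congr (_ + _); apply: eq_bigl => s.
  by rewrite ltnS -val_eqE /= ltn_neqAle andbC.
by rewrite ler_wpM2r ?expR_ge0.
Qed.

(** Chernoff's method: Markov's inequality for the exponential of the sum, at the best [lam]. The
    threshold is the deviation for which the optimal exponent is exactly [- L]. *)
Lemma bernstein_tail (L : R) : (0 < N)%N -> 0 <= L ->
  (forall lam (t : 'I_N) c, 0 <= lam < 3 ->
     \sum_(w | tr t w == c) mu w * expR (lam * D t w) <=
     expR (lam ^+ 2 / (8 * (1 - lam / 3))) * \sum_(w | tr t w == c) mu w) ->
  \sum_(w | Num.sqrt (L / (2 * N%:R)) + L / (3 * N%:R) <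
            N%:R^-1 * \sum_t D t w) mu w <=
  expR (- L) * \sum_w mu w.
Proof.
move=> N_gt0 L0 mgf.
have n0 : 0 < N%:R :> R by rewrite ltr0n.
set a := Num.sqrt _; have a0 : 0 <= a by rewrite sqrtr_ge0.
have LE : L = 2 * N%:R * a ^+ 2.
  by rewrite sqr_sqrtr ?divr_ge0 ?mulr_ge0 ?ler0n //; field; rewrite gt_eqF.
set n : R := N%:R in n0 LE *.
have -> : a + L / (3 * n) = a + 2 / 3 * a ^+ 2.
  by rewrite LE; field; rewrite gt_eqF.
pose den := 1 + 4 / 3 * a; have den0 : 0 < den by rewrite /den; lra.
(* The minimizer of lam |-> lam ^ 2 / (8 (1 - lam / 3)) - lam delta at
   delta = a + 2 a ^ 2 / 3; the minimum is exactly - 2 a ^ 2 = - L / N. *)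
pose lam := 4 * a / den.
have lam03 : 0 <= lam < 3.
  rewrite /lam divr_ge0 ?ltr_pdivrMr // /den; lra.
have mart := exp_supermartingale lam _ (fun t c => mgf lam t c lam03).
pose S := \sum_w mu w * expR (lam * \sum_t D t w).
pose x := lam * (n * (a + 2 / 3 * a ^+ 2)).
(* On the event the exponential is at least [expR x]; off the event the terms are nonnegative and
   are dropped. *)
have markov : (\sum_(w | a + 2 / 3 * a ^+ 2 < n^-1 * \sum_t D t w) mu w) *
    expR x <= S.
  rewrite /S
    [leRHS](bigID (fun w => a + 2 / 3 * a ^+ 2 < n^-1 * \sum_t D t w)) /=.
  apply: ler_wpDr; first by apply: sumr_ge0 => w _; rewrite mulr_ge0 ?expR_ge0.
  rewrite mulr_suml ler_sum // => w big.
  rewrite ler_wpM2l // ler_expR /x ler_wpM2l //; first by case/andP: lam03.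
  by rewrite -ler_pdivlMl // ltW.
have -> : expR (- L) =
    expR (n * (lam ^+ 2 / (8 * (1 - lam / 3)))) / expR x.
  rewrite -expRB; congr expR; rewrite LE /x.
  have -> : 1 - lam / 3 = den^-1.
    by rewrite /lam /den; field; rewrite gt_eqF //; lra.
  by rewrite /lam /den; field; rewrite gt_eqF //; lra.
by rewrite [leRHS]mulrAC ler_pdivlMr ?expR_gt0 // (le_trans markov).
Qed.

End FiniteMartingale.

(** * The regressors *)

Section Design.
Context {R : realType} {K d : nat}.
Implicit Types (h : 'M[bool]_(d, K)) (x : 'cV[R]_(kappa K d)).

Lemma eta_lshift h (k k' : 'I_K) :
  eta h (lshift (d * K ^ 2) k) k' = (k' == k)%:R :> R.
Proof.
rewrite mxE /intensity /bconst /blag mxE eqxx andbT eq_lshift big1 ?addr0 //.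
by move=> s _; apply: big1 => l _; rewrite mxE eq_rlshift mul0r.
Qed.

Lemma mxvec_index_inj m n (i i' : 'I_m) (j j' : 'I_n) :
  mxvec_index i j = mxvec_index i' j' -> i = i' /\ j = j'.
Proof.
have [g gK _] := curry_mxvec_bij m n => E.
have := gK (i, j) isT; have := gK (i', j') isT.
by rewrite /= E => -> [-> ->].
Qed.

(** A constant term or lag coefficient enters the intensity of one location only. That location does
    not depend on the window, so each entry of [Fop] follows a single scalar noise through time. *)
Lemma eta_single_column (i : 'I_(kappa K d)) :
  exists k, forall h k', k' != k -> eta h i k' = 0 :> R.
Proof.
case: (split_ordP i) => [k ->|j ->].
  by exists k => h k' k'k; rewrite eta_lshift (negbTE k'k).
case/mxvec_indexP: j => s kl.
rewrite -[kl]/(kl : 'I_(K * K)); case/mxvec_indexP: kl => k l.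
exists k => h k' k'k; rewrite mxE /intensity /bconst /blag mxE eq_lrshift add0r.
apply: big1 => s' _; apply: big1 => l' _; rewrite mxE eq_rshift.
case: eqP => [/mxvec_index_inj[_ /mxvec_index_inj[kk _]]|]; last first.
  by rewrite mul0r.
by rewrite kk eqxx in k'k.
Qed.

(** For a bit [e], the product [b * e] lies between [min(b, 0)] and [max(b, 0)]. *)
Lemma intensity_itv h x k : Bset x -> 0 <= intensity h x k <= 1.
Proof.
move=> /(_ k)[lo hi]; rewrite /intensity; apply/andP; split.
  apply: le_trans lo _; rewrite lerD2l; apply: ler_sum => s _.
  apply: ler_sum => l _.
  by case: (h s l); rewrite ?mulr1 ?mulr0 ge_min lexx ?orbT.
apply: le_trans hi; rewrite lerD2l; apply: ler_sum => s _.
apply: ler_sum => l _.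
by case: (h s l); rewrite ?mulr1 ?mulr0 le_max lexx ?orbT.
Qed.

Context {N : nat} (N_gt0 : (0 < N)%N).
Implicit Types w : 'M[bool]_(d + N, K).

Lemma Amat_psd w (g : 'cV[R]_(kappa K d)) : 0 <= (g^T *m Amat w *m g) 0 0.
Proof.
rewrite /Amat -scalemxAr -scalemxAl mxE mulr_ge0 ?invr_ge0 ?ler0n //.
rewrite mulmx_sumr mulmx_suml summxE sumr_ge0 // => t _.
set e := eta _; have -> : g^T *m (e *m e^T) *m g = (e^T *m g)^T *m (e^T *m g).
  by rewrite trmx_mul trmxK !mulmxA.
by rewrite mxE sumr_ge0 // => k _; rewrite mxE -expr2 sqr_ge0.
Qed.

(** The row of [eta] for a constant term is a basis vector whatever the window. Through
    [theta_le_diag] this gives [theta p (Amat w) <= 1]. *)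
Lemma Amat_lshift w (k : 'I_K) :
  Amat w (lshift (d * K ^ 2) k) (lshift (d * K ^ 2) k) = 1 :> R.
Proof.
rewrite /Amat mxE summxE (eq_bigr (fun=> 1)) => [|t _].
  by rewrite sumr_const card_ord mulVf // pnatr_eq0 -lt0n.
rewrite mxE (bigD1 k) //= big1 ?addr0 => [|k' k'k].
  by rewrite eta_lshift [_^T _ _]mxE eta_lshift eqxx mulr1.
by rewrite eta_lshift (negbTE k'k) mul0r.
Qed.

Lemma Fop_entryE w x i k :
  (forall h k', k' != k -> eta h i k' = 0 :> R) ->
  Fop w x i 0 = N%:R^-1 * \sum_(t < N) eta (window w t) i k *
    (intensity (window w t) x k - (w (rshift d t) k)%:R).
Proof.
move=> ik; rewrite /Fop /Amat /avec -scalemxAl mulmx_suml -scalerBr -sumrB.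
rewrite mxE summxE; congr (_ * _); apply: eq_bigr => t _.
rewrite -mulmxA -mulmxBr mxE (bigD1 k) //= big1 ?addr0 => [|k' k'k].
  by rewrite -eta_trP !mxE.
by rewrite ik ?mul0r.
Qed.

Lemma eq_window w w' (t : 'I_N) :
  (forall (j : 'I_(d + N)) k, (j < d + t)%N -> w j k = w' j k) ->
  window w t = window w' t.
Proof.
move=> ww'; apply/matrixP => s l; rewrite !mxE ww' //=.
(* The truncated subtraction [d + t - s.+1] is strictly below [d + t] because [s < d] forces [d] to
   be positive. *)
by rewrite ltn_subrL addn_gt0 (leq_ltn_trans _ (ltn_ord s)).
Qed.

End Design.

(** * The law of the trajectory *)

Section Fibers.
Context {disp : measure_display} {T : measurableType disp} {W : finType}.
Variable f : T -> W.
Hypothesis mf : forall h, measurable [set x | f x = h].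

Lemma preimage_fibers (Q : pred W) :
  [set x | Q (f x)] = \bigcup_(h in [set` Q]) [set x | f x = h].
Proof.
by apply/seteqP; split => x /= => [Qx|[h Qh ->] //]; exists (f x).
Qed.

Lemma measurable_fibers (Q : pred W) : measurable [set x | Q (f x)].
Proof.
rewrite preimage_fibers; apply: fin_bigcup_measurable => //.
Qed.

Lemma fine_prob_fibers {R : realType} (P : probability T R) (Q : pred W) :
  fine (P [set x | Q (f x)]) = \sum_(h | Q h) fine (P [set x | f x = h]).
Proof.
rewrite preimage_fibers measure_fin_bigcup //; last first.
  by move=> h h' _ _ [x [/= -> ->]].
have -> : [set` Q] = [set` enum Q].
  by apply/seteqP; split => h /=; rewrite mem_enum.
rewrite -fsbig_seq ?enum_uniq // big_enum /=.
by rewrite sum_fine // => h _; rewrite fin_num_measure.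
Qed.
End Fibers.

Section Trajectory.
Context {disp : measure_display} {T : measurableType disp} {R : realType}.
Context {K d N : nat}.
Variables (P : probability T R) (omega : 'I_(d + N) -> 'I_K -> {RV P >-> bool}).

Lemma measurable_trajectory_eq (h : 'M[bool]_(d + N, K)) :
  measurable [set x | trajectory omega x = h].
Proof.
have -> : [set x | trajectory omega x = h] =
    \bigcap_(jk in [set: 'I_(d + N) * 'I_K])
       (omega jk.1 jk.2 @^-1` [set h jk.1 jk.2]).
  apply/seteqP; split => x /= E.
    by move=> jk _ /=; rewrite -E mxE.
  by apply/matrixP => j k; rewrite mxE; exact: (E (j, k) I).
apply: fin_bigcap_measurable => [|jk _]; first exact: finite_finset.
exact: measurable_funPTI.
Qed.

Definition traj_prob (h : 'M[bool]_(d + N, K)) : R :=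
  fine (P [set x | trajectory omega x = h]).

Lemma prob_trajectory (Q : pred 'M[bool]_(d + N, K)) :
  fine (P [set x | Q (trajectory omega x)]) = \sum_(h | Q h) traj_prob h.
Proof. exact: (fine_prob_fibers _ measurable_trajectory_eq). Qed.

Lemma traj_prob_ge0 h : 0 <= traj_prob h.
Proof. by rewrite fine_ge0. Qed.

(* Erases everything from time [t] on: the fibers of [past t] are the
   possible histories before [t]. *)
Definition past (t : 'I_N) (h : 'M[bool]_(d + N, K)) : 'M[bool]_(d + N, K) :=
  \matrix_(j, k) ((j < d + t)%N && h j k).

Lemma eq_pastP t h h' : past t h = past t h' <->
  (forall (j : 'I_(d + N)) k, (j < d + t)%N -> h j k = h' j k).
Proof.
split => [/matrixP E j k jt|E]; first by have := E j k; rewrite !mxE jt.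
by apply/matrixP => j k; rewrite !mxE; case: ltnP => //= jt; rewrite E.
Qed.

Lemma history_eventE t h :
  history_event omega t h = [set x | past t (trajectory omega x) == past t h].
Proof.
apply/seteqP; split => x /= H.
  by apply/eqP/eq_pastP => j k jt; rewrite mxE H.
by move=> j k jt; have /eqP/eq_pastP/(_ j k jt) := H; rewrite mxE.
Qed.

(** The product form also covers histories of probability zero, on which the process hypothesis is
    silent: there both sides vanish. *)
Lemma bernoulli_process_past beta t h k : bernoulli_process omega beta ->
  \sum_(g | (past t g == past t h) && g (rshift d t) k) traj_prob g =
  intensity (window h t) beta k * \sum_(g | past t g == past t h) traj_prob g.
Proof.
move=> /(_ t h) B.
have Hp : fine (P (history_event omega t h)) =
    \sum_(g | past t g == past t h) traj_prob g.
  by rewrite history_eventE -prob_trajectory.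
have [H0|H0] := eqVneq (P (history_event omega t h)) 0%E.
  move: Hp; rewrite H0 /= => /esym Hp; rewrite Hp mulr0.
  apply/eqP; rewrite eq_le sumr_ge0 ?andbT => [|g _]; last exact: traj_prob_ge0.
  rewrite -[leRHS]Hp
    [leRHS](bigID (fun g : 'M[bool]_(d + N, K) => g (rshift d t) k)) /= lerDl.
  by apply: sumr_ge0 => g _; exact: traj_prob_ge0.
have := B H0 k; rewrite /condP Hp => <-.
rewrite divfK; last first.
  rewrite -Hp fine_eq0 // fin_num_measure // history_eventE.
  exact: (measurable_fibers _ measurable_trajectory_eq
    (fun g => past t g == past t h)).
rewrite -prob_trajectory; congr (fine (P _)).
rewrite history_eventE; apply/seteqP; split => x /=.
  by move=> /andP[-> ]; rewrite mxE.
by rewrite mxE => -[-> ->].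
Qed.

(** * Concentration of the noise given the initial fragment *)

Context (N_gt0 : (0 < N)%N) {beta : 'cV[R]_(kappa K d)}.
Hypothesis beta_B : Bset beta.
Hypothesis omega_beta : bernoulli_process omega beta.
Variable w0 : 'M[bool]_(d, K).

Definition starts (h : 'M[bool]_(d + N, K)) : bool :=
  [forall j, [forall k, h (lshift N j) k == w0 j k]].

Lemma startsP (h : 'M[bool]_(d + N, K)) :
  reflect (forall j k, h (lshift N j) k = w0 j k) (starts h).
Proof.
apply: (iffP forallP) => [H j k|H j]; first by have /forallP/(_ k)/eqP := H j.
by apply/forallP => k; rewrite H.
Qed.

Lemma initial_eventE :
  initial_event omega w0 = [set x | starts (trajectory omega x)].
Proof.
apply/seteqP; split => x /= => [H|/startsP H j k]; last by rewrite -H mxE.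
by apply/startsP => j k; rewrite mxE H.
Qed.

(** The conditional law given the initial fragment, left unnormalized: the bounds are proportional
    to the total mass, and the only division by it is in [condP_initial_ge]. *)
Definition start_prob (h : 'M[bool]_(d + N, K)) : R :=
  if starts h then traj_prob h else 0.

Lemma start_prob_ge0 h : 0 <= start_prob h.
Proof. by rewrite /start_prob; case: ifP => // _; exact: traj_prob_ge0. Qed.

(** Every past contains the initial rows, so [starts] is constant on a fiber of [past t]:
    restricting to the initial event keeps or kills whole fibers. *)
Lemma start_prob_past t h k :
  \sum_(g | (past t g == past t h) && g (rshift d t) k) start_prob g =
  intensity (window h t) beta k * \sum_(g | past t g == past t h) start_prob g.
Proof.
have same g : past t g == past t h -> starts g = starts h.
  move=> /eqP/eq_pastP E; apply/startsP/startsP => H j k';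
    by rewrite -H E //= ltn_addr.
have [sh|/negbTE sh] := boolP (starts h).
  under eq_bigr => g /andP[gh _] do rewrite /start_prob (same g gh) sh.
  under [in RHS]eq_bigr => g gh do rewrite /start_prob (same g gh) sh.
  exact: bernoulli_process_past.
rewrite big1 ?big1 ?mulr0 // => [g gh|g /andP[gh _]];
  by rewrite /start_prob (same g gh) sh.
Qed.

(** On a fiber of the past the window is fixed, so the entry of [eta] and the intensity [q] are
    constants. An entry 0 is trivial; an entry 1 leaves a centered Bernoulli variable up to sign. *)
Lemma noise_mgf (i : 'I_(kappa K d)) k (neg : bool) lam (t : 'I_N)
    (c : 'M[bool]_(d + N, K)) : 0 <= lam < 3 ->
  \sum_(g | past t g == c) start_prob g * expR (lam * ((-1) ^+ neg *
    (eta (window g t) i k * (intensity (window g t) beta k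
                             - (g (rshift d t) k)%:R)))) <=
  expR (lam ^+ 2 / (8 * (1 - lam / 3))) * \sum_(g | past t g == c) start_prob g.
Proof.
move=> lam03.
have [g0 /eqP <-|none] := pickP (fun g => past t g == c); last first.
  by rewrite !big_pred0 ?mulr0.
have win g : past t g == past t g0 -> window g t = window g0 t.
  by move=> /eqP/eq_pastP; exact: eq_window.
set q := intensity (window g0 t) beta k.
have q01 : 0 <= q <= 1 by exact: intensity_itv.
have A0 : 0 <= \sum_(g | past t g == past t g0) start_prob g.
  by apply: sumr_ge0 => g _; exact: start_prob_ge0.
rewrite (eq_bigr (fun g => start_prob g * expR (lam * ((-1) ^+ neg *
    (eta (window g0 t) i k * (q - (g (rshift d t) k)%:R)))))); last first.
  by move=> g gg0; rewrite win.
have [->|->] := eta01 (R := R) (window g0 t) i k.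
  under eq_bigr do rewrite mul0r !mulr0 expR0 mulr1.
  rewrite ler_peMl // -[leLHS]expR0 ler_expR divr_ge0 ?sqr_ge0 //.
  by case/andP: lam03 => _ lam3; lra.
have E := start_prob_past t g0 k.
under eq_bigr do rewrite mul1r.
case: neg.
  under eq_bigr do rewrite expr1 mulN1r opprB.
  exact: (centered_bernoulli_mgf _ start_prob_ge0 _
    (fun g => g (rshift d t) k) _ _ q01 lam03 E).
under eq_bigr do rewrite expr0 mul1r.
(* For the positive sign, [q - xi] is the centered version of the complement of [xi], a Bernoulli
   variable of parameter [1 - q]. *)
have q01' : 0 <= 1 - q <= 1 by case/andP: q01 => ? ?; apply/andP; split; lra.
have E' : \sum_(g | (past t g == past t g0) && ~~ g (rshift d t) k)
      start_prob g =
    (1 - q) * \sum_(g | past t g == past t g0) start_prob g.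
  rewrite mulrBl mul1r -E.
  rewrite
    [X in X - _](bigID (fun g : 'M[bool]_(d + N, K) => g (rshift d t) k)) /=.
  by rewrite addrAC subrr add0r.
have := centered_bernoulli_mgf _ start_prob_ge0 _
  (fun g => ~~ g (rshift d t) k) _ _ q01' lam03 E'.
congr (_ <= _); apply: eq_bigr => g _; congr (_ * expR (_ * _)).
by case: (g _ k) => /=; rewrite ?subr0; lra.
Qed.

Lemma Fop_entry_tail i (neg : bool) (L : R) : 0 <= L ->
  \sum_(g | Num.sqrt (L / (2 * N%:R)) + L / (3 * N%:R) <
             (-1) ^+ neg * Fop g beta i 0) start_prob g <=
  expR (- L) * \sum_g start_prob g.
Proof.
move=> L0; have [k ik] := @eta_single_column R K d i.
pose D (t : 'I_N) (g : 'M[bool]_(d + N, K)) : R := (-1) ^+ neg *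
  (eta (window g t) i k * (intensity (window g t) beta k
                           - (g (rshift d t) k)%:R)).
have DE g : (-1) ^+ neg * Fop g beta i 0 = N%:R^-1 * \sum_t D t g.
  by rewrite (Fop_entryE _ _ _ k) // mulrCA mulr_sumr.
under eq_bigl do rewrite DE.
apply: (bernstein_tail _ start_prob_ge0 past) => //.
  (* Increment [s] reads rows up to [d + s], all of which belong to the past of [t] when [s < t]. *)
  move=> s t g g' st /eq_pastP E; rewrite /D (@eq_window _ _ _ g g').
    by rewrite E //= ltn_add2l.
  by move=> j k' js; rewrite E // (ltn_trans js) // ltn_add2l.
by move=> lam t c; exact: noise_mgf.
Qed.

Lemma Fop_tail (L : R) : 0 <= L ->
  \sum_(g | Num.sqrt (L / (2 * N%:R)) + L / (3 * N%:R) <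
             lpnorm +oo%E (Fop g beta)) start_prob g <=
  2 * (kappa K d)%:R * expR (- L) * \sum_g start_prob g.
Proof.
move=> L0; set del := Num.sqrt _ + _.
have del0 : 0 <= del by rewrite addr_ge0 ?sqrtr_ge0 ?divr_ge0 ?mulr_ge0 ?ler0n.
pose B (p : 'I_(kappa K d) * bool) (g : 'M[bool]_(d + N, K)) :=
  del < (-1) ^+ p.2 * Fop g beta p.1 0.
apply: (@le_trans _ _ (\sum_p \sum_(g | B p g) start_prob g)).
  under [leRHS]eq_bigr do rewrite big_mkcond.
  rewrite exchange_big /= big_mkcond; apply: ler_sum => g _.
  have pos p : 0 <= (if B p g then start_prob g else 0).
    by case: ifP => // _; exact: start_prob_ge0.
  case: ifP => [big|_]; last by apply: sumr_ge0 => p _; exact: pos.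
  have [p Bp] : exists p, B p g.
    apply/existsP; rewrite -[X in is_true X]negbK negb_exists.
    apply/negP => /forallP none.
    (* If no signed entry exceeds [del], neither does the maximum of the absolute values; its
       default value 0 is covered by [del0]. *)
    move: big; rewrite ltNge => /negP; apply.
    apply/bigmax_leP; split => // i _.
    have := none (i, false); have := none (i, true).
    by rewrite /B /= expr0 expr1 mul1r mulN1r -!leNgt ler_norml lerNl => -> ->.
  by rewrite (bigD1 p) //= Bp lerDl; apply: sumr_ge0 => p' _; exact: pos.
apply: (@le_trans _ _ (\sum_(p : 'I_(kappa K d) * bool)
    expR (- L) * \sum_g start_prob g)).
  by apply: ler_sum => -[i neg] _; exact: Fop_entry_tail.
rewrite sumr_const card_prod card_ord card_bool -[leLHS]mulr_natl natrM.
by rewrite mulrA [2 * _]mulrC.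
Qed.

Lemma condP_initial_ge (Q : pred 'M[bool]_(d + N, K)) (eps : R) :
  P (initial_event omega w0) != 0%E ->
  \sum_(g | ~~ Q g) start_prob g <= eps * \sum_g start_prob g ->
  1 - eps <= condP P [set x | Q (trajectory omega x)] (initial_event omega w0).
Proof.
rewrite initial_eventE => P0 bad.
have tot : fine (P [set x | starts (trajectory omega x)]) = \sum_g start_prob g.
  by rewrite prob_trajectory big_mkcond.
rewrite /condP tot.
have tot0 : 0 < \sum_g start_prob g.
  rewrite -tot lt_neqAle fine_ge0 // andbT eq_sym fine_eq0 //.
  rewrite fin_num_measure //.
  exact: (measurable_fibers _ measurable_trajectory_eq).
rewrite ler_pdivlMr //.
have -> : [set x | Q (trajectory omega x)] `&`
    [set x | starts (trajectory omega x)]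
    = [set x | Q (trajectory omega x) && starts (trajectory omega x)].
  by apply/seteqP; split => x /= => [[-> ->]|/andP[]].
rewrite (prob_trajectory (fun g => Q g && starts g)) big_mkcondr /=.
rewrite -/start_prob mulrBl mul1r lerBlDr [leLHS](bigID Q) /= lerD2l //.
Qed.

End Trajectory.

(** * Assembly of the two claims *)

Theorem theorem1 (R : realType) (K d N : nat)
    (K_ge1 : (1 <= K)%N) (d_ge1 : (1 <= d)%N) (N_ge1 : (1 <= N)%N)
    (X : set 'cV[R]_(kappa K d)) (beta : 'cV[R]_(kappa K d))
    (X_convex : convex_set X) (X_compact : compact X) (X_sub : X `<=` Bset)
    (X_beta : X beta)
    (bhat : 'M[bool]_(d + N, K) -> 'cV[R]_(kappa K d))
    (bhatP : forall w, weak_VI_solution (Fop w) X (bhat w)) :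
  (forall (p : \bar R) (w : 'M[bool]_(d + N, K)), (1 <= p)%E ->
     ((lpnorm p (bhat w - beta))%:E <=
      unless0 (theta p (Amat w) * theta 1%E (Amat w))
        (lpnorm +oo%E (Fop w beta)
         / Num.sqrt (theta p (Amat w) * theta 1%E (Amat w))))%E)
  /\
  (forall (disp : measure_display) (T : measurableType disp)
     (P : probability T R) (omega : 'I_(d + N) -> 'I_K -> {RV P >-> bool}),
     bernoulli_process omega beta ->
     forall w0 : 'M[bool]_(d, K), P (initial_event omega w0) != 0%E ->
     forall eps : R, 0 < eps < 1 ->
     1 - eps <=
     condP P
       [set x | forall p : \bar R, (1 <= p)%E ->
          ((lpnorm p (bhat (trajectory omega x) - beta))%:E <=
           unless0 (theta p (Amat (trajectory omega x))
                    * theta 1%E (Amat (trajectory omega x)))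
             ((theta p (Amat (trajectory omega x))
               * theta 1%E (Amat (trajectory omega x)))^-1
              * (Num.sqrt (ln (2 * (kappa K d)%:R / eps) / (2 * N%:R))
                 + ln (2 * (kappa K d)%:R / eps) / (3 * N%:R))))%E]
       (initial_event omega w0)).
Proof.
have kappa_gt0 : (0 < kappa K d)%N by rewrite /kappa addn_gt0 K_ge1.
have th_ge0 p (w : 'M[bool]_(d + N, K)) : (1 <= p)%E ->
    0 <= theta p (Amat w : 'M[R]_(kappa K d)).
  by move=> p1; apply: theta_ge0 => //; exact: Amat_psd.
have th_le1 p (w : 'M[bool]_(d + N, K)) : (1 <= p)%E ->
    theta p (Amat w : 'M[R]_(kappa K d)) <= 1.
  move=> p1; rewrite -(Amat_lshift N_ge1 w (Ordinal K_ge1)).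
  by apply: theta_le_diag => //; exact: Amat_psd.
have bound p (w : 'M[bool]_(d + N, K)) : (1 <= p)%E ->
    0 < theta p (Amat w) * theta 1%E (Amat w) ->
    lpnorm p (bhat w - beta) <= lpnorm +oo%E (Fop w beta)
      / Num.sqrt (theta p (Amat w) * theta 1%E (Amat w)).
  move=> p1 th0; apply: (weak_VI_affine_bound _ _ _ X) => //; last exact: bhatP.
  by move=> g; exact: Amat_psd.
have th_gt0 p (w : 'M[bool]_(d + N, K)) : (1 <= p)%E ->
    theta p (Amat w : 'M[R]_(kappa K d)) * theta 1%E (Amat w) != 0 ->
    0 < theta p (Amat w : 'M[R]_(kappa K d)) * theta 1%E (Amat w).
  by move=> p1 th0; rewrite lt_neqAle eq_sym th0 mulr_ge0 // th_ge0.
split=> [p w p1|disp T P omega omega_beta w0 P0 eps /andP[eps0 eps1]].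
  rewrite /unless0; case: ifPn => [_|th0]; first exact: leey.
  by rewrite lee_fin bound // th_gt0.
set L := ln _; set del := Num.sqrt _ + _.
have k0R : 0 < 2 * (kappa K d)%:R :> R by rewrite mulr_gt0 // ltr0n.
have L0 : 0 <= L.
  apply: ln_ge0; rewrite ler_pdivlMr // mul1r (le_trans (ltW eps1)) //.
  have : 1 <= (kappa K d)%:R :> R by rewrite ler1n.
  lra.
(* The level [L] makes the union bound over [2 * kappa K d] signed entries add up to exactly
   [eps]. *)
have expL : 2 * (kappa K d)%:R * expR (- L) = eps.
  rewrite expRN lnK; last by rewrite posrE divr_gt0.
  by rewrite invf_div mulrC divfK // gt_eqF.
set Q := [set x | _].
pose q (w : 'M[bool]_(d + N, K)) : bool := `[< forall p : \bar R, (1 <= p)%E ->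
  ((lpnorm p (bhat w - beta))%:E <=
   unless0 (theta p (Amat w) * theta 1%E (Amat w))
     ((theta p (Amat w) * theta 1%E (Amat w))^-1 * del))%E >].
have -> : Q = [set x | q (trajectory omega x)].
  by apply/seteqP; split => x /asboolP.
apply: condP_initial_ge => //.
(* The single event that the sup norm of [Fop g beta] is at most [del] serves all [p] at once, since
   the first claim is deterministic; no union over [p] is taken. *)
apply: (@le_trans _ _ (\sum_(g | del < lpnorm +oo%E (Fop g beta))
    start_prob P omega w0 g)); last first.
  by rewrite -expL; apply: Fop_tail => //; exact: X_sub.
rewrite big_mkcond [leRHS]big_mkcond /=; apply: ler_sum => w _.
case: ifPn => [/asboolPn nq|_]; last first.
  by case: ifP => // _; exact: start_prob_ge0.
case: ltP => // small; exfalso; apply: nq => p p1.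
rewrite /unless0; case: ifPn => [_|th0]; first exact: leey.
have th := th_gt0 p w p1 th0; set D := _ * _ in th *.
have D1 : D <= 1 by rewrite mulr_ile1 ?th_ge0 ?th_le1.
(* As [Num.sqrt D <= 1], squaring it can only decrease it; hence the inverse of [Num.sqrt D] is at
   most that of [D]. *)
have DsD : D <= Num.sqrt D.
  rewrite -[leLHS]sqr_sqrtr ?(ltW th) // expr2 ler_piMr ?sqrtr_ge0 //.
  by rewrite -sqrtr1 ler_wsqrtr.
rewrite lee_fin (le_trans (bound p w p1 th)) // mulrC.
apply: ler_pM => //; rewrite ?invr_ge0 ?sqrtr_ge0 ?lpnorm_ge0 //.
by rewrite lef_pV2 // posrE sqrtr_gt0.
Qed.
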